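(* Let $(B\subset C,D\subset A)$ be a quadruple of simple unital $C^*$-algebras, with $B\subset A$ an irreducible inclusion (i.e. $B'\cap A=\mathbb{C}1$) and with a conditional expectation $E$ from $A$ onto $B$ of index-finite type. Let $\Theta=e_Ce_D\in B'\cap A_1$ be the angle operator and $H$ the von Neumann entropy. If $H(|\Theta|^2)=0$, then $$e_Ce_D=e_De_C=e_{C\cap D}.$$
   Context: All inclusions are unital (common identity); in a quadruple $(B\subset C,D\subset A)$, $C$ and $D$ are intermediate to $B\subset A$. A conditional expectation $E:A\to B$ is of index-finite type if there is a finite quasi-basis $\{\lambda_1,\dots,\lambda_n\}\subset A$, i.e. $x=\sum_i\lambda_iE(\lambda_i^*x)$ for all $x\in A$; then $\mathrm{Ind}_w(E)=\sum_i\lambda_i\lambda_i^*$ (Watatani index, a scalar when $A$ is simple). For simple unital $B\subset A$ with an expectation of index-finite type there is a unique minimal conditional expectation $E^A_B$ (the one of smallest index). $A_1$ is the $C^*$-basic construction of $B\subset A$ with respect to $E^A_B$, i.e. the algebra of adjointable right $B$-linear maps of the Hilbert $B$-module $A$ (inner product $E^A_B(x^*y)$), generated by $A$ (left multiplication) and the Jones projection $e_1:a\mapsto E^A_B(a)$. It is simple, and $E^{A_1}_A$ denotes the minimal conditional expectation $A_1\to A$. The relative commutant $B'\cap A_1$ is finite-dimensional and $\mathrm{tr}:=E^A_B\circ E^{A_1}_A$ restricted to $B'\cap A_1$ is a faithful tracial state. Intermediate algebras: for an intermediate simple unital $C^*$-subalgebra $B\subset P\subset A$ there are minimal conditional expectations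 $E^A_P$ and $E^P_B=E^A_B|_P$ with $E^A_B=E^P_B\circ E^A_P$. The Jones projection $e_P$ of $E^A_P$ is the map $a\mapsto E^A_P(a)$, viewed as an element of $B'\cap A_1$. This is applied to $P=C$, $D$ and $C\cap D$. Entropy: $\eta(t)=-t\log t$ for $t>0$, $\eta(0)=0$. For $x\in B'\cap A_1$, $|x|^2=x^*x$ and $H(|x|^2)=\mathrm{tr}(\eta(|x|^2))$ (functional calculus). *)

(* Defs.v *)
From HB Require Import structures.
From mathcomp Require Import all_boot all_order all_algebra.
From mathcomp Require Import all_classical reals topology normedtype exp.
From mathcomp.real_closed Require Export complex.

Set Implicit Arguments.
Unset Strict Implicit.
Unset Printing Implicit Defensive.

Import Order.TTheory GRing.Theory Num.Theory.
Import numFieldNormedType.Exports.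

Local Open Scope classical_set_scope.
Local Open Scope ring_scope.
Local Open Scope complex_scope.

(* Unital C*-algebras over the complex numbers R[i].  The norm is a field of
   the structure because the library has no structure that is both a ring and
   a normed module (and Hierarchy Builder rejects that join, numDomainType being
   already declared); completeness is stated for sequences. *)
HB.mixin Record isCStarAlgebra (R : realType) A of GRing.Algebra R[i] A := {
  star : A -> A;
  cnorm : A -> R;
  starK : involutive star;
  starD : {morph star : x y / x + y};
  starZ : forall (c : R[i]) (x : A), star (c *: x) = c^* *: star x;
  starM : forall x y : A, star (x * y) = star y * star x;
  cnorm_eq0 : forall x : A, cnorm x = 0 -> x = 0;
  cnorm_triangle : forall x y : A, cnorm (x + y) <= cnorm x + cnorm y;
  cnormZ : forall (c : R[i]) (x : A),
    cnorm (c *: x) = ComplexField.Normc.normc c * cnorm x;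
  cnormM : forall x y : A, cnorm (x * y) <= cnorm x * cnorm y;
  cnorm_cstar : forall x : A, cnorm (star x * x) = cnorm x ^+ 2;
  cnorm_complete : forall u : nat -> A,
    (forall e : R, 0 < e -> exists N : nat, forall m n : nat,
       (N <= m)%N -> (N <= n)%N -> cnorm (u m - u n) < e) ->
    exists l : A, (fun n => cnorm (u n - l)) @ \oo --> (0 : R)
}.

#[short(type="cstarAlgType")]
HB.structure Definition CStarAlgebra (R : realType) :=
  {A of isCStarAlgebra R A & GRing.Algebra R[i] A}.

Section CStar.
Context (R : realType) (A : cstarAlgType R).
Implicit Types (P I : set A) (E : A -> A) (l : seq A).

Definition cstar_closed (S : set A) : Prop :=
  forall (u : nat -> A) (a : A), (forall n, S (u n)) ->
    (fun n => cnorm (u n - a)) @ \oo --> (0 : R) -> S a.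

Record cstar_subalgebra P : Prop := {
  subalg_1 : P 1;
  subalg_D : forall x y, P x -> P y -> P (x + y);
  subalg_Z : forall (c : R[i]) x, P x -> P (c *: x);
  subalg_M : forall x y, P x -> P y -> P (x * y);
  subalg_star : forall x, P x -> P (star x);
  subalg_closed : cstar_closed P
}.

Record closed_ideal P I : Prop := {
  ideal_sub : I `<=` P;
  ideal_0 : I 0;
  ideal_D : forall x y, I x -> I y -> I (x + y);
  ideal_Ml : forall p x, P p -> I x -> I (p * x);
  ideal_Mr : forall p x, P p -> I x -> I (x * p);
  ideal_closed : cstar_closed I
}.

Definition simple_algebra P : Prop :=
  forall I, closed_ideal P I -> I = [set 0] \/ I = P.

Definition rel_commutant P : set A := [set x | forall b, P b -> b * x = x * b].

Definition irreducible_inclusion P : Prop :=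
  rel_commutant P = range (fun c : R[i] => c%:A).

Definition cpos P (x : A) : Prop := exists2 z, P z & x = star z * z.

Definition cle (x y : A) : Prop := cpos setT (y - x).

(* Maps into P are represented as maps A -> A with values in P. *)
Record cond_exp P E : Prop := {
  ce_linear : forall (c : R[i]) x y, E (c *: x + y) = c *: E x + E y;
  ce_in : forall x, P (E x);
  ce_id : forall b, P b -> E b = b;
  ce_bimodule : forall b b' x, P b -> P b' -> E (b * x * b') = b * E x * b';
  ce_pos : forall x, cpos P (E (star x * x))
}.

Definition quasi_basis E l : Prop :=
  forall x, x = \sum_(u <- l) u * E (star u * x).

Definition watatani_index l : A := \sum_(u <- l) u * star u.

Definition index_finite P E : Prop :=
  cond_exp P E /\ exists l, quasi_basis E l.

(* The Watatani index does not depend on the quasi-basis; it is a scalar when A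
   is simple, and then [cle] compares these scalars. *)
Definition minimal_cond_exp P E : Prop :=
  index_finite P E /\
  forall F l m, index_finite P F -> quasi_basis E l -> quasi_basis F m ->
    cle (watatani_index l) (watatani_index m).

Definition cinvertible (x : A) : Prop := exists y, x * y = 1 /\ y * x = 1.

(* Only the real points: used for self-adjoint elements. *)
Definition spectrum (a : A) : set R :=
  [set t : R | ~ cinvertible (a - (t%:C)%:A)].

(* Phi is the continuous functional calculus of the self-adjoint element a,
   i.e. the unital *-homomorphism from C(spectrum a) to C*(1, a) that sends the
   identity function to a.  It is given on real functions, which determine it,
   and is unconstrained on functions that are not continuous on spectrum a. *)
Record functional_calculus (a : A) (Phi : (R -> R) -> A) : Prop := {
  fc_ext : forall f g : R -> R,
    {within spectrum a, continuous f} -> {within spectrum a, continuous g} ->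
    (forall t, spectrum a t -> f t = g t) -> Phi f = Phi g;
  fc_1 : Phi (fun=> 1) = 1;
  fc_id : Phi (fun t => t) = a;
  fc_D : forall f g : R -> R,
    {within spectrum a, continuous f} -> {within spectrum a, continuous g} ->
    Phi (fun t => f t + g t) = Phi f + Phi g;
  fc_Z : forall (c : R) (f : R -> R), {within spectrum a, continuous f} ->
    Phi (fun t => c * f t) = c%:C *: Phi f;
  fc_M : forall f g : R -> R,
    {within spectrum a, continuous f} -> {within spectrum a, continuous g} ->
    Phi (fun t => f t * g t) = Phi f * Phi g;
  fc_star : forall f : R -> R, {within spectrum a, continuous f} ->
    star (Phi f) = Phi f;
  fc_in : forall (f : R -> R) P, {within spectrum a, continuous f} ->
    cstar_subalgebra P -> P a -> P (Phi f)
}.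

End CStar.

Section BasicConstruction.
Context (R : realType) (A A1 : cstarAlgType R).
Implicit Types (B : set A) (E : A -> A).

(* Right B-linear maps of A that are adjointable for <x, y> = E (x^* y). *)
Definition adjointable B E (T : A -> A) : Prop :=
  (forall x y b, B b -> T (x * b + y) = T x * b + T y) /\
  exists S : A -> A, forall x y, E (star (T x) * y) = E (star x * S y).

(* rep identifies the *-algebra A1 with the adjointable operators, and inc is
   the embedding of A in A1 by left multiplication.  The norm of A1 is then the
   operator norm, a *-algebra having at most one complete C*-norm. *)
Record basic_construction B E (rep : A1 -> A -> A) (inc : A -> A1) : Prop := {
  bc_inj : injective rep;
  bc_range : range rep = adjointable B E;
  bc_linear : forall (c : R[i]) S T x,
    rep (c *: S + T) x = c *: rep S x + rep T x;
  bc_1 : forall x, rep 1 x = x;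
  bc_M : forall S T x, rep (S * T) x = rep S (rep T x);
  bc_star : forall T x y, E (star (rep T x) * y) = E (star x * rep (star T) y);
  bc_inc : forall a x, rep (inc a) x = a * x
}.

(* e is the map x |-> EP x, viewed in A1. *)
Definition jones_projection (rep : A1 -> A -> A) (EP : A -> A) (e : A1) : Prop :=
  forall x, rep e x = EP x.

Definition eta (t : R) : R := if 0 < t then - t * ln t else 0.

(* H(|x|^2) = h, where tr = E \o E1 takes scalar values on B' `&` A1. *)
Definition entropy_eq E (E1 : A1 -> A) (x : A1) (h : R) : Prop :=
  exists Phi : (R -> R) -> A1,
    functional_calculus (star x * x) Phi /\ E (E1 (Phi eta)) = (h%:C)%:A.

End BasicConstruction.

(* Main.v *)
(* Write [tr] for [E^A_B \o E^A1_A], [x = e_C e_D] and [a = x^* x].  Since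
   [t - t^2 <= eta t] for all real [t], [eta (a)] is the sum of [a - a^2] and of a
   square [s^2] with [s] self-adjoint; moreover [a - a^2 = r^* r] with
   [r = (1 - e_D) e_C e_D].  So [tr (r^* r) + tr (s^2) = 0], and [tr] being positive
   and faithful, [r = 0], i.e. [e_C e_D = e_D e_C e_D] is self-adjoint.
   An expectation with a quasi-basis is faithful, by a Cauchy-Schwarz argument,
   and a sum of positive elements vanishes only if they do; both facts follow from
   [|k|^2 <= 6 |v^* v + k k^*|], a quantitative form of the positivity of [v^* v].
   Irreducibility makes the expectation onto [B] unique, whence
   [E_B \o E_P = E_B] for the intermediate algebras [P]. *)
Require Import Defs.
From mathcomp Require Import all_boot all_order all_algebra.
From mathcomp Require Import all_classical reals topology normedtype exp.
From mathcomp Require Import sequences realfun ring lra.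

Set Implicit Arguments.
Unset Strict Implicit.
Unset Printing Implicit Defensive.

Import Order.TTheory GRing.Theory Num.Theory.
Import numFieldNormedType.Exports.

Local Open Scope classical_set_scope.
Local Open Scope ring_scope.

(* Decides equalities of non-commutative rings: expands both sides into sums of
   monomials and cancels these two by two. *)
Ltac to_front t := lazymatch goal with
  | |- t + _ = 0 => idtac
  | _ => rewrite (addrCA _ t); to_front t
  end.
Ltac cancel_pair := lazymatch goal with
  | |- - ?a + _ = 0 => to_front a; rewrite addNKr
  | |- ?a + _ = 0 => to_front (- a); rewrite addKr
  end.
Ltac ncring :=
  apply/eqP; rewrite -subr_eq0; apply/eqP;
  rewrite ?(mulrDl, mulrDr, mulNr, mulrN, opprD, opprK, mulrA, mul1r, mulr1,
    mul0r, mulr0, oppr0, add0r, addr0);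
  rewrite -?addrA -[LHS]addr0 -?addrA; repeat cancel_pair; by [].

(** * Positivity in C*-algebras *)

Section NormTheory.
Local Open Scope complex_scope.
Context (R : realType) (A : cstarAlgType R).
Implicit Types (x y z a b s h : A) (t c d g e : R) (u : nat -> A).

(** Real scalars and [i] are embedded as central elements of the algebra, so that identities become
    ring identities, within reach of [ncring]. *)
Definition scal (t : R) : A := (t%:C)%:A.
Definition im : A := ('i%C : R[i])%:A.

Lemma scaler_scal t x : t%:C *: x = scal t * x.
Proof. by rewrite /scal mulr_algl. Qed.

Lemma scalC t x : scal t * x = x * scal t.
Proof. by rewrite /scal mulr_algl mulr_algr. Qed.

Lemma scal0 : scal 0 = 0. Proof. by rewrite /scal rmorph0 scale0r. Qed.
Lemma scal1 : scal 1 = 1. Proof. by rewrite /scal rmorph1 scale1r. Qed.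

Lemma scalD c d : scal (c + d) = scal c + scal d.
Proof. by rewrite /scal rmorphD scalerDl. Qed.

Lemma scalM c d : scal (c * d) = scal c * scal d.
Proof. by rewrite /scal rmorphM -scalerA mulr_algl. Qed.

Lemma imC x : im * x = x * im.
Proof. by rewrite /im mulr_algl mulr_algr. Qed.

Lemma imim : im * im = -1.
Proof. by rewrite /im mulr_algl scalerA -expr2 sqr_i scaleN1r. Qed.

Lemma star0 : star (0 : A) = 0.
Proof. by apply: (addIr (star 0)); rewrite -starD !add0r. Qed.

Lemma starN x : star (- x) = - star x.
Proof. by apply/eqP; rewrite -addr_eq0 -starD addNr star0. Qed.

Lemma starB x y : star (x - y) = star x - star y.
Proof. by rewrite starD starN. Qed.

Lemma star1 : star (1 : A) = 1.
Proof. by rewrite -[RHS]starK -[star 1 in RHS]mulr1 starM starK mulr1. Qed.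

Lemma star_scal t : star (scal t) = scal t.
Proof.
rewrite /scal starZ star1; congr (_ *: _).
by apply/eqP; rewrite eq_complex /= oppr0 !eqxx.
Qed.

Lemma star_im : star im = - im.
Proof.
rewrite /im starZ star1 -scaleNr; congr (_ *: _).
by apply/eqP; rewrite eq_complex /= oppr0 !eqxx.
Qed.

Lemma normc_real t : ComplexField.Normc.normc (t%:C) = `|t|.
Proof. by rewrite /= expr0n /= addr0 sqrtr_sqr. Qed.

Lemma cnorm0 : cnorm (0 : A) = 0.
Proof. by rewrite -[0 : A](scale0r (0 : A)) cnormZ ComplexField.Normc.normc0 mul0r. Qed.

Lemma cnormN x : cnorm (- x) = cnorm x.
Proof. by rewrite -scaleN1r -[-1]/(- 1%:C) -rmorphN cnormZ normc_real normrN1 mul1r. Qed.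

Lemma cnorm_ge0 x : 0 <= cnorm x.
Proof.
have := cnorm_triangle x (- x); rewrite subrr cnorm0 cnormN; lra.
Qed.

Lemma cnormB x y : cnorm (x - y) <= cnorm x + cnorm y.
Proof. by rewrite -(cnormN y) cnorm_triangle. Qed.

Lemma cnormBC x y : cnorm (x - y) = cnorm (y - x).
Proof. by rewrite -cnormN opprB. Qed.

Lemma cnorm1 : cnorm (1 : A) = 1.
Proof.
have h : cnorm (1 : A) = cnorm (1 : A) ^+ 2.
  by rewrite -cnorm_cstar star1 mul1r.
have : cnorm (1 : A) != 0.
  by apply/eqP => /cnorm_eq0/eqP; rewrite oner_eq0.
by move/mulfI; apply; rewrite mulr1 -expr2 -h.
Qed.

Lemma cnorm_scal t : cnorm (scal t) = `|t|.
Proof. by rewrite /scal cnormZ normc_real cnorm1 mulr1. Qed.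

Lemma cnorm_scalM t x : cnorm (scal t * x) = `|t| * cnorm x.
Proof. by rewrite -scaler_scal cnormZ normc_real. Qed.

Lemma cnorm_imM x : cnorm (im * x) = cnorm x.
Proof.
by rewrite /im mulr_algl cnormZ /= expr0n expr1n add0r sqrtr1 mul1r.
Qed.

Lemma cnorm_star x : cnorm (star x) = cnorm x.
Proof.
have le z : cnorm z <= cnorm (star z).
  have := cnormM (star z) z; rewrite cnorm_cstar expr2.
  have := cnorm_ge0 z; rewrite le_eqVlt => /predU1P[<- _|z0].
    exact: cnorm_ge0.
  by rewrite ler_pM2r.
by apply/eqP; rewrite eq_le le andbT; have := le (star x); rewrite starK.
Qed.

Lemma cnorm_sqr s : star s = s -> cnorm (s * s) = cnorm s ^+ 2.
Proof. by move=> ss; rewrite -{1}ss cnorm_cstar. Qed.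

Lemma star_exp s n : star s = s -> star (s ^+ n) = s ^+ n.
Proof.
move=> ss; elim: n => [|n ih]; first by rewrite expr0 star1.
by rewrite exprSr starM ih ss -exprS exprSr.
Qed.

(** Iterated squaring with the C*-identity; these powers play the role of the spectral radius
    formula. *)
Lemma cnorm_exp2n s k : star s = s -> cnorm (s ^+ (2 ^ k)) = cnorm s ^+ (2 ^ k).
Proof.
move=> ss; elim: k => [|k ih]; first by rewrite !expr1.
by rewrite expnSr !exprM expr2 cnorm_sqr ?ih // star_exp.
Qed.

Lemma cvg_cnorm_lt u a : (fun n => cnorm (u n - a)) @ \oo --> (0 : R) ->
  forall e, 0 < e -> exists n, cnorm (u n - a) < e.
Proof.
move=> h e e0.
have : \forall n \near \oo, `|0 - cnorm (u n - a)| < e.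
  by move/cvgrPdist_lt: h; apply.
move=> [N _ /(_ N (leqnn N))] /=; rewrite sub0r normrN => le.
by exists N; exact: le_lt_trans (ler_norm _) le.
Qed.

Lemma le_addgt0 c d : (forall e, 0 < e -> c <= d + e) -> c <= d.
Proof. by move=> h; apply/ler_addgt0Pr. Qed.

Lemma closed_ball c : cstar_closed [set y : A | cnorm y <= c].
Proof.
move=> u a hu /cvg_cnorm_lt ua /=; apply: le_addgt0 => e /ua[n lt].
have -> : a = u n - (u n - a) by rewrite opprB addrC subrK.
by apply: le_trans (cnormB _ _) _; have := hu n; rewrite /= ; lra.
Qed.

Lemma cnorm_eq_small x : (forall e, 0 < e -> cnorm x <= e) -> x = 0.
Proof.
move=> h; apply: cnorm_eq0; apply/eqP; rewrite eq_le cnorm_ge0 andbT.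
by apply: le_addgt0 => e /h; rewrite add0r.
Qed.

Lemma closed_selfadjoint : cstar_closed [set y : A | star y = y].
Proof.
move=> u a hu /cvg_cnorm_lt ua /=; apply/eqP; rewrite -subr_eq0; apply/eqP.
apply: cnorm_eq_small => e e0.
have /ua[n lt] : 0 < e / 2 by lra.
have -> : star a - a = (u n - a) - star (u n - a).
  by rewrite starB hu opprB [RHS]addrC addrA subrK.
by apply: le_trans (cnormB _ _) _; rewrite cnorm_star; lra.
Qed.

Lemma closed_commutant z : cstar_closed [set y : A | z * y = y * z].
Proof.
move=> u a hu /cvg_cnorm_lt ua /=; apply/eqP; rewrite -subr_eq0; apply/eqP.
apply: cnorm_eq_small => e e0.
have z0 := cnorm_ge0 z.
have /ua[n lt] : 0 < e / (2 * (cnorm z + 1)) by apply: divr_gt0; lra.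
have -> : z * a - a * z = (u n - a) * z - z * (u n - a).
  have h : z * u n = u n * z := hu n.
  by rewrite mulrBl mulrBr h; ncring.
apply: le_trans (cnormB _ _) _.
have h1 := cnormM (u n - a) z; have h2 := cnormM z (u n - a).
have h0 := cnorm_ge0 (u n - a).
have : cnorm (u n - a) * (2 * (cnorm z + 1)) < e.
  by rewrite -ltr_pdivlMr //; lra.
nra.
Qed.

Lemma contraction_fixpoint (S : set A) (f : A -> A) (k : R) y0 :
  0 <= k -> k < 1 -> cstar_closed S -> S y0 -> (forall y, S y -> S (f y)) ->
  (forall y z, S y -> S z -> cnorm (f y - f z) <= k * cnorm (y - z)) ->
  exists2 y, S y & f y = y.
Proof.
move=> k0 k1 clS Sy0 Sf lip.
pose u n := iter n f y0.
have Su n : S (u n) by elim: n => // n ih; apply: Sf.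
pose C := cnorm (u 1%N - u 0%N).
have C0 : 0 <= C by apply: cnorm_ge0.
have step n : cnorm (u n.+1 - u n) <= k ^+ n * C.
  elim: n => [|n ih]; first by rewrite expr0 mul1r.
  apply: le_trans (lip _ _ (Su n.+1) (Su n)) _.
  by rewrite exprS -mulrA ler_wpM2l.
(* Multiplying by [1 - k] turns the geometric sum of the steps into a telescoping difference. *)
have far n m : (1 - k) * cnorm (u (n + m)%N - u n) <= (k ^+ n - k ^+ (n + m)) * C.
  elim: m => [|m ih]; first by rewrite addn0 !subrr cnorm0 mulr0 mul0r.
  have -> : u (n + m.+1)%N - u n = (u (n + m).+1 - u (n + m)%N) + (u (n + m)%N - u n).
    by rewrite addnS addrA subrK.
  have := cnorm_triangle (u (n + m).+1 - u (n + m)%N) (u (n + m)%N - u n).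
  move: (step (n + m)%N); rewrite addnS (exprS k (n + m)).
  move: (cnorm _) (cnorm (_ + _)) (cnorm _) ih => p q r ih h1 h2; nra.
have far' n m : (1 - k) * cnorm (u (n + m)%N - u n) <= k ^+ n * C.
  apply: le_trans (far n m) _; rewrite ler_wpM2r // gerBl exprn_ge0 //.
have kn0 e : 0 < e -> exists N, forall n, (N <= n)%N -> k ^+ n * C < e.
  move=> e0; have : geometric C k @ \oo --> 0.
    by apply: cvg_geometric; rewrite ger0_norm.
  move/cvgrPdist_lt => /(_ e e0)[N _ hN]; exists N => n /hN /=.
  rewrite sub0r normrN /geometric /= mulrC; apply: le_lt_trans; exact: ler_norm.
have cauchy e : 0 < e -> exists N : nat, forall m n : nat,
    (N <= m)%N -> (N <= n)%N -> cnorm (u m - u n) < e.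
  move=> e0; have [N hN] := kn0 ((1 - k) * e) ltac:(nra); exists N.
  have le p q : (N <= p)%N -> (p <= q)%N -> cnorm (u q - u p) < e.
    move=> Np pq; have := far' p (q - p)%N; rewrite subnKC // => h.
    have := le_lt_trans h (hN _ Np); rewrite ltr_pM2l //; lra.
  move=> m n Nm Nn; case: (leqP m n) => mn; first by rewrite cnormBC le.
  by rewrite le // ltnW.
have [l ul] := cnorm_complete u cauchy.
have Sl : S l by apply: clS ul.
exists l => //; apply/eqP; rewrite -subr_eq0; apply/eqP.
apply: cnorm_eq_small => e e0.
have e4 : 0 < e / 4 by lra.
have : \forall n \near \oo, `|0 - cnorm (u n - l)| < e / 4.
  by move/cvgrPdist_lt: ul; apply.
move=> [N _ hN].
have cl n : (N <= n)%N -> cnorm (u n - l) < e / 4.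
  by move=> /hN /=; rewrite sub0r normrN; apply: le_lt_trans; exact: ler_norm.
have -> : f l - l = (u N.+1 - l) - (u N.+1 - f l).
  by ncring.
apply: le_trans (cnormB _ _) _.
have := lip _ _ (Su N) Sl; have := cl _ (leqnn N); have := cl _ (leqnSn N).
have := cnorm_ge0 (u N - l); rewrite -/(u N.+1); nra.
Qed.

(* Halving the fixed-point equation [2 y = x + y^2] makes it a contraction. *)
Lemma sqrt_exists x : star x = x -> cnorm x < 1 ->
  exists y, [/\ star y = y, (1 - y) * (1 - y) = 1 - x &
    forall z, z * x = x * z -> z * y = y * z].
Proof.
move=> sx x1.
(* The norm bound makes [f] a contraction of ratio [cnorm x] on this set. The last clause survives
   limits, so the fixed point commutes with whatever commutes with [x]. *)
pose S := [set y : A | [/\ cnorm y <= cnorm x, star y = y &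
   forall z, z * x = x * z -> z * y = y * z]].
pose f y := scal 2^-1 * (x + y * y).
have x0 := cnorm_ge0 x.
have [||y|y z|y [ny sy cy] fy] := @contraction_fixpoint S f (cnorm x) 0 x0 x1.
- move=> u a Su ua; split.
  + by apply: (closed_ball _ ua) => n; have [] := Su n.
  + by apply: (closed_selfadjoint _ ua) => n; have [] := Su n.
  + move=> z zx; apply: (closed_commutant (z := z) _ ua) => n.
    by have [_ _] := Su n; apply.
- by split; rewrite ?cnorm0 ?star0 // => z _; rewrite mulr0 mul0r.
- move=> [ny sy cy]; split.
  + rewrite cnorm_scalM ger0_norm ?invr_ge0 //.
    have := cnorm_triangle x (y * y); have := cnormM y y.
    have := cnorm_ge0 y; nra.
  + by rewrite starM star_scal -scalC starD sx starM sy.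
  + move=> z zx; rewrite /f mulrA -scalC -!mulrA; congr (_ * _).
    by rewrite mulrDr mulrDl zx mulrA (cy z zx) -!mulrA (cy z zx).
- move=> [ny sy _] [nz sz _].
  have -> : f y - f z = scal 2^-1 * (y * (y - z) + (y - z) * z).
    by rewrite /f; ncring.
  rewrite cnorm_scalM ger0_norm ?invr_ge0 //.
  have := cnorm_triangle (y * (y - z)) ((y - z) * z).
  have := cnormM y (y - z); have := cnormM (y - z) z.
  have := cnorm_ge0 (y - z); nra.
exists y; split => //.
have : scal 2 * y = x + y * y.
  rewrite -{1}fy /f mulrA -scalM mulfV ?pnatr_eq0 // scal1 mul1r //.
rewrite (_ : 2 = 1 + 1) // scalD scal1 mulrDl mul1r => yy.
have -> : x = y + y - y * y by rewrite yy addrK.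
ncring.
Qed.

(** The normalization [x] of [g + s * s] has norm below 1, so [c - s * s], which is
    [(g + c) * (1 - x)], has a self-adjoint root [r] commuting with [s]. Then [u := s + i r]
    satisfies [star u * u = c], and its real and imaginary parts [s] and [r] have norm at most
    [cnorm u]. *)
Lemma selfadjoint_sqr_le s g c : star s = s -> 0 <= g -> 0 <= c ->
  cnorm (scal g + s * s) < g + c ->
  cnorm s ^+ 2 <= c /\ cnorm (scal c - s * s) <= c.
Proof.
move=> ss g0 c0 lt.
have d0 : 0 < g + c by apply: le_lt_trans (cnorm_ge0 _) lt.
pose x := scal (g + c)^-1 * (scal g + s * s).
have sx : star x = x by rewrite /x starM star_scal -scalC starD star_scal starM ss.
have x1 : cnorm x < 1.
  by rewrite cnorm_scalM gtr0_norm ?invr_gt0 // ltr_pdivrMl // mulr1.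
have [y [sy yy cy]] := sqrt_exists sx x1.
have cs : s * y = y * s.
  apply: cy; rewrite /x mulrA -scalC -!mulrA; congr (_ * _).
  by rewrite mulrDl mulrDr -scalC mulrA.
pose r := scal (Num.sqrt (g + c)) * (1 - y).
have rr : r * r = scal c - s * s.
  rewrite /r mulrA -[_ * (1 - y) * scal _]mulrA -scalC mulrA -scalM -expr2.
  rewrite sqr_sqrtr ?(ltW d0) // -mulrA yy mulrBr mulr1 /x mulrA -scalM.
  by rewrite mulfV ?gt_eqF // scal1 mul1r scalD; ncring.
have sr : star r = r by rewrite /r starM star_scal -scalC starB star1 sy.
have cr : s * r = r * s.
  by rewrite /r mulrA -scalC -!mulrA; congr (_ * _); rewrite mulrBr mulrBl cs mulr1 mul1r.
pose u := s + im * r.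
have su : star u = s - im * r.
  by rewrite /u starD starM star_im ss sr mulrN -imC.
have uu : cnorm u ^+ 2 = c.
  rewrite -cnorm_cstar su; have -> : (s - im * r) * u = scal c.
    have e1 : im * r * (im * r) = - (r * r).
      by rewrite -mulrA (mulrA r) -imC -mulrA mulrA imim mulN1r.
    have e2 : im * r * s = s * (im * r) by rewrite -mulrA -cr mulrA imC mulrA.
    by rewrite /u mulrDr !mulrBl e1 e2 rr; ncring.
  by rewrite cnorm_scal ger0_norm.
have half z : cnorm (scal 2 * z) = 2 * cnorm z by rewrite cnorm_scalM ger0_norm.
have two : scal 2 = 1 + 1 by rewrite -[2]/(1 + 1) scalD scal1.
have ns : cnorm s <= cnorm u.
  have := half s; have -> : scal 2 * s = u + star u by rewrite su two /u; ncring.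
  by have := cnorm_triangle u (star u); rewrite cnorm_star; lra.
have nr : cnorm r <= cnorm u.
  have := half (im * r).
  have -> : scal 2 * (im * r) = u - star u by rewrite su two /u; ncring.
  by have := cnormB u (star u); rewrite cnorm_star cnorm_imM; lra.
have s0 := cnorm_ge0 s; have r0 := cnorm_ge0 r.
by rewrite -rr cnorm_sqr //; split; rewrite -uu lerXn2r ?nnegrE ?cnorm_ge0.
Qed.

(** If [c < a], the powers of [a / c = 1 + b] outgrow every linear function of the exponent. *)
Lemma le_of_pow2_le_linear (a c d : R) : 0 < a -> 0 < c -> 0 <= d ->
  (forall k, a ^+ (2 ^ k) * c <= c ^+ (2 ^ k) * (c + (2 ^ k)%:R * d)) -> a <= c.
Proof.
move=> a0 c0 d0 h; rewrite leNgt; apply/negP => ca.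
pose b := a / c - 1.
have b0 : 0 < b by rewrite /b subr_gt0 ltr_pdivlMr // mul1r.
have bern n : 1 + n%:R * b <= (1 + b) ^+ n.
  elim: n => [|n ih]; first by rewrite mul0r addr0 expr0.
  rewrite exprS -addn1 natrD; have n0 : 0 <= n%:R :> R by [].
  by apply: le_trans (_ : (1 + b) * (1 + n%:R * b) <= _); [nra|rewrite ler_wpM2l //; lra].
have ub k : (1 + b) ^+ (2 ^ k) <= 1 + (2 ^ k)%:R * (d / c).
  have -> : 1 + b = a / c by rewrite /b addrC subrK.
  rewrite expr_div_n ler_pdivrMr ?exprn_gt0 // -(ler_pM2r c0).
  apply: le_trans (h k) _; rewrite le_eqVlt; apply/orP; left; apply/eqP.
  by field; rewrite gt_eqF.
(* Bernoulli's inequality is itself only linear in the exponent [m]; its square, at exponent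
   [2 * m], contains the term [m ^+ 2 * b ^+ 2]. *)
have key k : (2 ^ k)%:R * b ^+ 2 <= 2 * (d / c).
  have := ub k.+1; have := bern (2 ^ k)%N.
  rewrite expnSr exprM natrM; set m : R := (2 ^ k)%:R; set q := _ ^+ (2 ^ k).
  have m1 : 1 <= m by rewrite ler1n expn_gt0.
  have dc : 0 <= d / c by rewrite divr_ge0 // ltW.
  move=> h1 h2; have h3 : (1 + m * b) ^+ 2 <= q ^+ 2.
    by rewrite lerXn2r ?nnegrE //; nra.
  have h4 : m * (m * b ^+ 2) <= m * (2 * (d / c)) by nra.
  by rewrite ler_pM2l in h4 => //; lra.
have b2 : 0 < b ^+ 2 by rewrite exprn_gt0.
pose N := Num.truncn (2 * (d / c) / b ^+ 2).
have hN : 2 * (d / c) / b ^+ 2 < N.+1%:R by rewrite /N truncnS_gt.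
have := key N.+1; rewrite -ler_pdivlMr // => le.
have : N.+1%:R < (2 ^ N.+1)%:R :> R by rewrite ltr_nat ltn_expl.
lra.
Qed.

(* The powers of [g + x x^*] are intertwined with those of [g + x^* x] by [x],
   so the norm of the [m]-th power of the former is at most [c ^ m], up to a
   factor linear in [m]; as [g + x x^*] is self-adjoint, [m := 2 ^ k] concludes. *)
Lemma cnorm_swap x g c : 0 < g -> g <= c ->
  cnorm (scal g + star x * x) <= c -> cnorm (scal g + x * star x) <= c.
Proof.
move=> g0 gc le; have c0 : 0 < c by lra.
set p := scal g + star x * x in le; set q := scal g + x * star x.
have sq : star q = q by rewrite /q starD star_scal starM starK.
have inter n : q ^+ n * x = x * p ^+ n.
  elim: n => [|n ih]; first by rewrite !expr0 mul1r mulr1.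
  have qx : q * x = x * p by rewrite /q /p mulrDl mulrDr scalC !mulrA.
  by rewrite exprSr -mulrA qx mulrA ih -mulrA -exprSr.
have np n : cnorm (p ^+ n) <= c ^+ n.
  elim: n => [|n ih]; first by rewrite !expr0 cnorm1.
  rewrite !exprS; apply: le_trans (cnormM _ _) _.
  by apply: ler_pM => //; apply: cnorm_ge0.
have [->|q0] := eqVneq q 0; first by rewrite cnorm0 ltW.
have nq : 0 < cnorm q.
  by rewrite lt_neqAle cnorm_ge0 eq_sym andbT; apply: contraNneq q0 => /cnorm_eq0 ->.
apply: (@le_of_pow2_le_linear _ _ (cnorm x ^+ 2)) => //.
  by rewrite exprn_ge0 ?cnorm_ge0.
have bound n : cnorm (q ^+ n) * c <= c ^+ n * (c + n%:R * cnorm x ^+ 2).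
  elim: n => [|n ih]; first by rewrite !expr0 cnorm1 mul0r addr0.
  (* This gives [cnorm (q ^+ n.+1) <= g * cnorm (q ^+ n) + cnorm x ^+ 2 * c ^+ n]; as [g <= c], each
     step adds one multiple of [cnorm x ^+ 2]. *)
  have -> : q ^+ n.+1 = scal g * q ^+ n + x * p ^+ n * star x.
    by rewrite exprSr {2}/q mulrDr scalC mulrA inter.
  have h1 := cnorm_triangle (scal g * q ^+ n) (x * p ^+ n * star x).
  have h2 : cnorm (scal g * q ^+ n) = g * cnorm (q ^+ n).
    by rewrite cnorm_scalM gtr0_norm.
  have h3 : cnorm (x * p ^+ n * star x) <= cnorm x ^+ 2 * c ^+ n.
    apply: le_trans (cnormM _ _) _; rewrite cnorm_star expr2 mulrAC.
    rewrite ler_wpM2r ?cnorm_ge0 //; apply: le_trans (cnormM _ _) _.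
    by rewrite ler_wpM2l ?cnorm_ge0.
  have cn : 0 < c ^+ n by rewrite exprn_gt0.
  rewrite exprS -addn1 natrD mulrDl mul1r.
  have X0 : 0 <= cnorm x ^+ 2 by rewrite exprn_ge0 ?cnorm_ge0.
  have t0 : 0 <= c + n%:R * cnorm x ^+ 2 by have := mulr_ge0 (ler0n R n) X0; lra.
  have h4 : g * (cnorm (q ^+ n) * c) <= g * (c ^+ n * (c + n%:R * cnorm x ^+ 2)).
    by rewrite ler_wpM2l // ltW.
  have h5 : g * (c ^+ n * (c + n%:R * cnorm x ^+ 2)) <=
            c * (c ^+ n * (c + n%:R * cnorm x ^+ 2)).
    by rewrite ler_wpM2r // mulr_ge0 // ltW.
  rewrite h2 in h1; have h6 := le_trans h1 (lerD (lexx _) h3).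
  rewrite -(ler_pM2r c0) in h6; apply: le_trans h6 _; lra.
move=> k; rewrite -cnorm_exp2n //.
Qed.

(* With [x := k^* v^*], [x^* x] is minus the square of [v v^*] up to the
   conjugate by [v^*] of [v^* v + k k^*],
   hence both [x^* x] and [x x^*] are almost negative, whereas their sum is twice
   a sum of squares of self-adjoint elements. *)
Lemma cnorm_sum_squares v k :
  cnorm k ^+ 2 <= 6 * cnorm (star v * v + k * star k : A).
Proof.
set w := star v * v + k * star k.
pose p := v * star v; pose x := star k * star v; pose d := cnorm w * cnorm v ^+ 2.
have sp : star p = p by rewrite /p starM starK.
have np : cnorm p = cnorm v ^+ 2.
  by rewrite -(cnorm_star v) -cnorm_cstar starK.
have v0 := cnorm_ge0 v; have w0 := cnorm_ge0 w.
have d0 : 0 <= d by rewrite mulr_ge0 // exprn_ge0.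
have sx : star x = v * k by rewrite /x starM !starK.
have xx : star x * x = v * w * star v - p * p.
  by rewrite sx /x /w /p; ncring.
have nvwv : cnorm (v * w * star v) <= d.
  apply: le_trans (cnormM _ _) _; rewrite cnorm_star /d expr2 mulrA.
  by rewrite ler_wpM2r // mulrC cnormM.
have sqr_small s c : star s = s -> cnorm s ^+ 2 < c -> cnorm (scal c - s * s) <= c.
  move=> ss lt; have c0 : 0 <= c by apply: ltW; apply: le_lt_trans lt; rewrite exprn_ge0 ?cnorm_ge0.
  by apply: (proj2 (@selfadjoint_sqr_le s 0 c _ _ _ _)); rewrite // scal0 !add0r cnorm_sqr.
(* The [+ 1] provides the strict inequality that [sqr_small] asks for. *)
pose g := cnorm p ^+ 2 + 1.
have g0 : 0 < g by rewrite /g ltr_wpDl // exprn_ge0 ?cnorm_ge0.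
have n1 : cnorm (scal g + star x * x) <= g + d.
  have -> : scal g + star x * x = (scal g - p * p) + v * w * star v.
    by rewrite xx; ncring.
  apply: le_trans (cnorm_triangle _ _) _; apply: lerD => //.
  by apply: sqr_small; rewrite // /g ltrDl.
have n2 : cnorm (scal g + x * star x) <= g + d by apply: cnorm_swap; rewrite // lerDl.
(* Twice the real and imaginary parts of [x], so that [a * a + b * b] is twice
   [star x * x + x * star x]. *)
pose a := x + star x; pose b := im * (star x - x).
have sa : star a = a by rewrite /a starD starK addrC.
have sb : star b = b by rewrite /b starM star_im starB starK mulrN -imC -mulrN opprB.
have two : scal 2 = 1 + 1 by rewrite -[2]/(1 + 1) scalD scal1.
have bb : b * b = - ((star x - x) * (star x - x)).
  by rewrite /b mulrA -[im * _ * im]mulrA -imC mulrA imim -mulrA mulN1r.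
have nab : cnorm (scal (4 * g) + a * a + b * b) <= 4 * (g + d).
  have -> : scal (4 * g) + a * a + b * b =
      scal 2 * ((scal g + star x * x) + (scal g + x * star x)).
    have -> : scal (4 * g) = (1 + 1) * ((1 + 1) * scal g).
      by rewrite -two -!scalM; congr scal; ring.
    by rewrite bb /a two; ncring.
  rewrite cnorm_scalM ger0_norm //.
  by have := cnorm_triangle (scal g + star x * x) (scal g + x * star x); lra.
have bound (s t : A) : star s = s -> star t = t ->
    cnorm (scal (4 * g) + s * s + t * t) <= 4 * (g + d) -> cnorm s ^+ 2 <= 4 * d.
  move=> ss st le; apply: le_addgt0 => e e0.
  (* Adding [h - t * t], of norm at most [h], trades the square of [t] for a shift by [h], which
     leaves the bound on [s] unchanged. *)
  pose h := cnorm t ^+ 2 + 1.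
  have h0 : 0 < h by rewrite /h ltr_wpDl // exprn_ge0 ?cnorm_ge0.
  apply: (proj1 (@selfadjoint_sqr_le s (4 * g + h) _ _ _ _ _)) => //; try lra.
  have -> : scal (4 * g + h) + s * s =
      (scal (4 * g) + s * s + t * t) + (scal h - t * t) by rewrite scalD; ncring.
  apply: le_lt_trans (cnorm_triangle _ _) _.
  by have := sqr_small t h st ltac:(by rewrite /h ltrDl); lra.
have na := bound _ _ sa sb nab.
have nb : cnorm b ^+ 2 <= 4 * d by apply: (bound _ _ sb sa); rewrite addrAC.
have nx : cnorm x ^+ 2 <= 4 * d.
  have : cnorm (scal 2 * x) = 2 * cnorm x by rewrite cnorm_scalM ger0_norm.
  have -> : scal 2 * x = a + im * b by rewrite /b mulrA imim two /a; ncring.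
  have := cnorm_triangle a (im * b); rewrite cnorm_imM => le eq2; rewrite eq2 in le.
  have x0 := cnorm_ge0 x; have a0 := cnorm_ge0 a; have b0 := cnorm_ge0 b.
  have : (2 * cnorm x) ^+ 2 <= (cnorm a + cnorm b) ^+ 2.
    by rewrite lerXn2r ?nnegrE ?addr_ge0 ?mulr_ge0.
  have := sqr_ge0 (cnorm a - cnorm b); move: na nb; rewrite !expr2; lra.
(* Here 5 is 1 from [v * w * star v] plus 4 from [star x * x]. Since [cnorm p = cnorm v ^+ 2], one
   factor [cnorm v ^+ 2] cancels; [k * star k = w - star v * v] then raises 5 to 6. *)
have npp : cnorm p ^+ 2 <= 5 * d.
  have -> : cnorm p ^+ 2 = cnorm (v * w * star v - star x * x).
    by rewrite -cnorm_sqr // xx; congr cnorm; ncring.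
  by apply: le_trans (cnormB _ _) _; rewrite cnorm_cstar; lra.
have nv : cnorm v ^+ 2 <= 5 * cnorm w.
  move: npp; rewrite np /d expr2 mulrA.
  have := exprn_ge0 2 v0; rewrite le_eqVlt => /predU1P[<- _|vv]; first by lra.
  by rewrite ler_pM2r.
have <- : cnorm (k * star k) = cnorm k ^+ 2.
  by rewrite -(cnorm_star k) -cnorm_cstar starK.
have -> : k * star k = w - star v * v by rewrite /w; ncring.
by apply: le_trans (cnormB _ _) _; rewrite cnorm_cstar; lra.
Qed.
End NormTheory.


(** * Conditional expectations *)

Section CondExp.
Context (R : realType) (A : cstarAlgType R) (P : set A) (E : A -> A).
(** Stated for a set with a unit and an involution, so that the lemmas apply directly to the range
    of [inc]. *)
Hypotheses (P1 : P 1) (Pstar : forall x, P x -> P (star x)) (ceE : cond_exp P E).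
Implicit Types (x y z b : A) (l : seq A).

Lemma ceD x y : E (x + y) = E x + E y.
Proof. by have := ce_linear ceE 1 x y; rewrite !scale1r. Qed.

Lemma ce0 : E 0 = 0.
Proof. by apply: (addIr (E 0)); rewrite -ceD !add0r. Qed.

Lemma ceZ (c : R[i]) x : E (c *: x) = c *: E x.
Proof. by have := ce_linear ceE c x 0; rewrite ce0 !addr0. Qed.

Lemma ceN x : E (- x) = - E x.
Proof. by rewrite -scaleN1r ceZ scaleN1r. Qed.

Lemma ceB x y : E (x - y) = E x - E y.
Proof. by rewrite ceD ceN. Qed.

Lemma ce_sum l (F : A -> A) : E (\sum_(u <- l) F u) = \sum_(u <- l) E (F u).
Proof. exact: (big_morph E ceD ce0). Qed.

Lemma ceMl b x : P b -> E (b * x) = b * E x.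
Proof. by move=> Pb; have := ce_bimodule ceE x Pb P1; rewrite !mulr1. Qed.

Lemma ceMr b x : P b -> E (x * b) = E x * b.
Proof. by move=> Pb; have := ce_bimodule ceE x P1 Pb; rewrite !mul1r. Qed.

(* By positivity, [f x := E (star x) - star (E x)] vanishes on each [star x * x];
   polarization with [x + 1] and [x + 'i] then gives [f = 0]. *)
Lemma ce_star x : E (star x) = star (E x).
Proof.
pose f x := E (star x) - star (E x).
have fD y z : f (y + z) = f y + f z.
  by rewrite /f !(starD, ceD); ncring.
have fsq y : f (star y * y) = 0.
  have [z _ eqz] := ce_pos ceE y.
  by rewrite /f starM starK eqz starM starK subrr.
have fim y : f (im A * y) = - (im A * f y).
  have E_im z : E (im A * z) = im A * E z by rewrite /im !mulr_algl ceZ.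
  by rewrite /f E_im !starM !star_im !mulrN -!imC ceN E_im; ncring.
have f1 : f 1 = 0 by have := fsq 1; rewrite star1 mulr1.
have pol1 : f (star x) + f x = 0.
  have := fsq (x + 1).
  have -> : star (x + 1) * (x + 1) = star x * x + star x + x + 1.
    by rewrite starD star1; ncring.
  by rewrite !fD fsq f1 add0r addr0.
have pol2 : f x - f (star x) = 0.
  have := fsq (x + im A).
  have -> : star (x + im A) * (x + im A) = star x * x + im A * star x + im A * (- x) + 1.
    have i2 := imim A.
    rewrite starD star_im mulrDl !mulrDr mulNr -imC !mulNr i2; ncring.
  rewrite !fD fsq f1 add0r addr0 !fim.
  have -> : f (- x) = - f x by apply/eqP; rewrite -addr_eq0 -fD addNr /f ce0 !star0 ce0 subrr.
  move=> h; have : im A * (- (im A * f (star x)) - im A * - f x) = 0 by rewrite h mulr0.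
  rewrite mulrBr !mulrN !mulrA imim !mulN1r !opprK => e.
  by rewrite -opprB e oppr0.
have : f x + f x = 0.
  have -> : f x + f x = (f (star x) + f x) + (f x - f (star x)) by ncring.
  by rewrite pol1 pol2 addr0.
rewrite -mulr2n -scaler_nat => /eqP; rewrite scaler_eq0 pnatr_eq0 /= => /eqP fx0.
by apply/eqP; rewrite -subr_eq0; apply/eqP.
Qed.

Lemma quasi_basis_nondegenerate l x : quasi_basis E l ->
  (forall y, E (star y * x) = 0) -> x = 0.
Proof. by move=> qb h; rewrite (qb x) big1 // => u _; rewrite h mulr0. Qed.

(* If [E (star x * x) = 0] and [k := E (star y * x)], then
   [E (star z * z) = E (star y * y) - 2 t (k * star k)] for [z := y - t x * star k],
   and this is positive for every [t]. *)
Lemma ce_faithful l x : quasi_basis E l -> E (star x * x) = 0 -> x = 0.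
Proof.
move=> qb x0; apply: (quasi_basis_nondegenerate qb) => y.
set k := E (star y * x).
have Pk : P k := ce_in ceE _.
have ks : E (star x * y) = star k by rewrite /k -ce_star starM starK.
have bound (n : nat) : n.+1%:R * cnorm k ^+ 2 <= 3 * cnorm (E (star y * y)).
  pose z := y - scal A n.+1%:R * (x * star k).
  have [v _] := ce_pos ceE z.
  have -> : star z * z = star y * y - scal A n.+1%:R * (star y * x * star k)
      - scal A n.+1%:R * (k * (star x * y))
      + scal A n.+1%:R * (scal A n.+1%:R * (k * (star x * x) * star k)).
    rewrite /z starB !starM starK star_scal.
    have mv w w' : w * (scal A n.+1%:R * w') = scal A n.+1%:R * (w * w').
      by rewrite mulrA -scalC mulrA.
    rewrite -(scalC _ (k * star x)) mulrBl !mulrBr -!mulrA (mv (star y)) (mv (star x)) (mv k); ncring.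
  have ceC t w : E (scal A t * w) = scal A t * E w by rewrite -!scaler_scal ceZ.
  rewrite ceD !ceB !ceC (ceMr _ (Pstar Pk)) (ceMl _ Pk) ks (ceMr _ (Pstar Pk)) (ceMl _ Pk) x0.
  rewrite mulr0 mul0r !mulr0 addr0 -/k => eqv.
  (* With [s * k] in place of [k], the sum in [cnorm_sum_squares] is exactly [E (star y * y)]; the
     factor 2 in [s] reduces its constant 6 to 3. *)
  pose s := Num.sqrt (2 * n.+1%:R : R).
  have := cnorm_sum_squares v (scal A s * k).
  have -> : star v * v + scal A s * k * star (scal A s * k) = E (star y * y).
    rewrite -eqv starM star_scal -scalC.
    have -> : scal A s * k * (scal A s * star k) = scal A (s ^+ 2) * (k * star k).
      by rewrite expr2 scalM -!mulrA; congr (_ * _); rewrite !mulrA scalC.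
    rewrite sqr_sqrtr ?mulr_ge0 // (_ : 2 * n.+1%:R = n.+1%:R + n.+1%:R) ?scalD; last by ring.
    by ncring.
  rewrite cnorm_scalM exprMn real_normK ?num_real // sqr_sqrtr ?mulr_ge0 //.
  lra.
apply: cnorm_eq0; apply/eqP; rewrite -sqrf_eq0 eq_le exprn_ge0 ?cnorm_ge0 // andbT.
rewrite leNgt; apply/negP => k0.
pose N := Num.truncn (3 * cnorm (E (star y * y)) / cnorm k ^+ 2).
have : 3 * cnorm (E (star y * y)) / cnorm k ^+ 2 < N.+1%:R by rewrite truncnS_gt.
by rewrite ltNge ler_pdivlMr // bound.
Qed.

Lemma rel_commutant_sub x : irreducible_inclusion P -> rel_commutant P x -> P x.
Proof.
by move=> irr; rewrite irr => -[c _ <-]; rewrite -(ce_id ceE P1) -ceZ; exact: (ce_in ceE).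
Qed.

(* A [P]-bimodule map [F] has the form [E (h * _)] with
   [h := \sum_(u <- l) F u * star u], and [h] commutes with [P]. *)
Lemma irreducible_ce_unique l (F : A -> A) :
  irreducible_inclusion P -> quasi_basis E l ->
  (forall x y, F (x + y) = F x + F y) -> F 1 = 1 ->
  (forall x, P (F x)) ->
  (forall b x, P b -> F (b * x) = b * F x) ->
  (forall b x, P b -> F (x * b) = F x * b) -> F =1 E.
Proof.
move=> irr qb FD F1 PF FMl FMr.
pose h := \sum_(u <- l) F u * star u.
have F0 : F 0 = 0 by apply: (addIr (F 0)); rewrite -FD !add0r.
(* After expanding [x] in the quasi-basis, the factors [E (star u * x)] leave [F] on the right and
   the factors [F u] enter [E] on the left. *)
have Fh x : F x = E (h * x).
  rewrite {1}(qb x) (big_morph F FD F0) /h mulr_suml ce_sum.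
  by apply: eq_bigr => u _; rewrite (FMr _ _ (ce_in ceE _)) -mulrA (ceMl _ (PF u)).
(* For every [y], [E ((b * h - h * b) * y) = b * F y - F (b * y) = 0]; adjoints bring this to the
   form asked by nondegeneracy. *)
have hcomm : rel_commutant P h.
  move=> b Pb; apply/eqP; rewrite -subr_eq0; apply/eqP.
  rewrite -[LHS]starK; rewrite (@quasi_basis_nondegenerate l (star (b * h - h * b)) qb) ?star0 //.
  move=> y; rewrite -starM ce_star mulrBl ceB -(mulrA b) ceMl // -(mulrA h) -!Fh FMl //.
  by rewrite subrr star0.
have Ph := rel_commutant_sub irr hcomm.
have h1 : h = 1 by rewrite -(ce_id ceE Ph) -[h]mulr1 -Fh.
by move=> x; rewrite Fh h1 mul1r.
Qed.

End CondExp.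

(** * The entropy function *)

Section Eta.
Context (R : realType).
Implicit Types t x : R.

Lemma ln_le_sub1 t : 0 < t -> ln t <= t - 1.
Proof. by move=> t0; have := @le_ln1Dx R (t - 1); rewrite addrCA subrr addr0; apply; lra. Qed.

Lemma eta_ge t : t - t * t <= eta t.
Proof.
rewrite /eta; case: ifPn => [t0|]; last by rewrite -leNgt => t0; nra.
have := ln_le_sub1 t0; nra.
Qed.

(** Serves continuity at 0. It is [ln_le_sub1] at the inverse of [Num.sqrt t], as [ln t] is twice
    [ln (Num.sqrt t)]. *)
Lemma eta_le_sqrt t : 0 < t -> eta t <= 2 * Num.sqrt t.
Proof.
move=> t0; rewrite /eta t0.
set s := Num.sqrt t; have s0 : 0 < s by rewrite sqrtr_gt0.
have ts : t = s * s by rewrite -expr2 sqr_sqrtr // ltW.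
have : ln s^-1 <= s^-1 - 1 by rewrite ln_le_sub1 // invr_gt0.
rewrite lnV ?posrE // {1}ts ts lnM ?posrE // => h.
have : s * - ln s <= s * (s^-1 - 1) by rewrite ler_pM2l.
rewrite mulrBr mulfV ?gt_eqF // mulr1; nra.
Qed.

Lemma continuous_eta : continuous (@eta R).
Proof.
move=> t; have [t0|t0|->] := ltgtP t 0.
- have nt : \forall x \near t, x < 0 by exact: lt_nbhsl.
  rewrite /continuous_at; have -> : eta t = 0 by rewrite /eta ltNge ltW.
  apply: cvg_near_cst.
  by near=> x; apply/eqP; rewrite /eta ltNge ltW //; near: x.
- have nt : \forall x \near t, 0 < x by exact: lt_nbhsr.
  rewrite /continuous_at.
  have -> : eta t = - t * ln t by rewrite /eta t0.
  apply: (@cvg_trans _ ((fun x => - x * ln x) @ t)).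
    by apply: near_eq_cvg; near=> x; rewrite /eta ifT //; near: x.
  have h1 : (fun x : R => - x) @ t --> - t by apply: cvgN; apply: cvg_id.
  have h2 : (fun x : R => ln x) @ t --> ln t by apply: continuous_ln.
  exact: (cvgM h1 h2).
- rewrite /continuous_at /eta ltxx -/(@eta R); apply/cvgrPdist_lt => e e0.
  have h2 : \forall x \near (0 : R), `|0 - 2 * Num.sqrt x| < e.
    have : (fun x : R => 2 * Num.sqrt x) @ (0 : R) --> 2 * Num.sqrt (0 : R).
      have c2 : (fun=> 2 : R) @ (0 : R) --> (2 : R) by apply: cvg_cst.
      have cs : (fun x : R => Num.sqrt x) @ (0 : R) --> Num.sqrt (0 : R).
        by apply: sqrt_continuous.
      exact: (cvgM c2 cs).
    by rewrite sqrtr0 mulr0 => /cvgrPdist_lt; apply.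
  (* For [0 < x < 1], [eta_ge] gives [0 <= eta x], the lower half of the squeeze. *)
  have h1 : \forall x \near (0 : R), x < 1 by exact: lt_nbhsl.
  near=> x.
  have x1 : x < 1 by near: x.
  have : `|0 - 2 * Num.sqrt x| < e by near: x.
  rewrite !sub0r !normrN; apply: le_lt_trans.
  have [x0|x0] := ltP 0 x; last by rewrite /eta ltNge x0 normr0.
  rewrite (ger0_norm (_ : 0 <= eta x)) ?(le_trans (eta_le_sqrt x0)) ?ler_norm //.
  by apply: le_trans (eta_ge x); nra.
Unshelve. all: by end_near.
Qed.
End Eta.

(** * The basic construction *)

Section Tower.
Context (R : realType) (A : cstarAlgType R) (B : set A) (EB : A -> A) (l : seq A).
Hypotheses (subB : cstar_subalgebra B) (irr : irreducible_inclusion B).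
Hypotheses (ceEB : cond_exp B EB) (qbEB : quasi_basis EB l).
Implicit Types (x y a : A).

Lemma ce_tower (P : set A) (F : A -> A) : P 1 -> B `<=` P -> cond_exp P F ->
  forall x, EB (F x) = EB x.
Proof.
move=> P1 BP ceF; have B1 := subalg_1 subB.
apply: (irreducible_ce_unique B1 ceEB irr qbEB (F := EB \o F)).
- by move=> x y; rewrite /= (ceD ceF) (ceD ceEB).
- by rewrite /= (ce_id ceF) // (ce_id ceEB).
- by move=> x; apply: (ce_in ceEB).
- by move=> b x Bb; rewrite /= (ceMl P1 ceF) ?(ceMl B1 ceEB) //; apply: BP.
- by move=> b x Bb; rewrite /= (ceMr P1 ceF) ?(ceMr B1 ceEB) //; apply: BP.
Qed.

Lemma ce_tower_faithful x : EB (star x * x) = 0 -> x = 0.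
Proof. exact: (ce_faithful (subalg_1 subB) (subalg_star subB) ceEB qbEB). Qed.

Context (A1 : cstarAlgType R) (rep : A1 -> A -> A) (inc : A -> A1).
Hypothesis (bcA1 : basic_construction B EB rep inc).
Implicit Types (S T : A1).

Lemma rep_inj S T : (forall x, rep S x = rep T x) -> S = T.
Proof. by move=> h; apply: (bc_inj bcA1); apply: funext. Qed.

(** Computes adjoints in [A1] through the action on [A]: the pairing [EB (star x * y)] is
    nondegenerate and [rep] is injective. *)
Lemma star_unique S T :
  (forall x y, EB (star (rep T x) * y) = EB (star x * rep S y)) -> star T = S.
Proof.
move=> h; apply: rep_inj => x; apply/eqP; rewrite -subr_eq0; apply/eqP.
apply: (quasi_basis_nondegenerate qbEB) => y.
by rewrite mulrBr (ceB ceEB) -(bc_star bcA1) h subrr.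
Qed.

(** By [ce_tower], [F] may be inserted under [EB]; both [EB (star (F x) * y)] and
    [EB (star x * F y)] then become [EB (star (F x) * F y)]. *)
Lemma jones_projection_selfadjoint (P : set A) (F : A -> A) (e : A1) :
  P 1 -> (forall x, P x -> P (star x)) -> B `<=` P -> cond_exp P F ->
  jones_projection rep F e -> star e = e.
Proof.
move=> P1 Pstar BP ceF je; apply: star_unique => x y; rewrite !je.
rewrite -(ce_tower P1 BP ceF (star x * _)) -(ce_tower P1 BP ceF (star (F x) * _)).
rewrite (ceMr P1 ceF _ (ce_in ceF _)) (ceMl P1 ceF _ (Pstar _ (ce_in ceF _))).
by rewrite (ce_star ceF).
Qed.

Lemma jones_projection_idem (P : set A) (F : A -> A) (e : A1) :
  cond_exp P F -> jones_projection rep F e -> e * e = e.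
Proof.
move=> ceF je; apply: rep_inj => x; rewrite (bc_M bcA1) !je.
by rewrite (ce_id ceF) //; apply: (ce_in ceF).
Qed.

Lemma inc_inj : injective inc.
Proof.
move=> a b eq; have := bc_inc bcA1 a 1.
by rewrite eq (bc_inc bcA1) !mulr1.
Qed.

Lemma repD S T x : rep (S + T) x = rep S x + rep T x.
Proof. by have := bc_linear bcA1 1 S T x; rewrite !scale1r. Qed.

Lemma incD a b : inc (a + b) = inc a + inc b.
Proof. by apply: rep_inj => x; rewrite repD !(bc_inc bcA1) mulrDl. Qed.

Lemma inc0 : inc 0 = 0.
Proof. by apply: (addIr (inc 0)); rewrite -incD !add0r. Qed.

Lemma inc1 : inc 1 = 1.
Proof. by apply: rep_inj => x; rewrite (bc_inc bcA1) (bc_1 bcA1) mul1r. Qed.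

Lemma incM a b : inc (a * b) = inc a * inc b.
Proof. by apply: rep_inj => x; rewrite (bc_M bcA1) !(bc_inc bcA1) mulrA. Qed.

Lemma inc_star a : inc (star a) = star (inc a).
Proof.
by apply/esym/star_unique => x y; rewrite !(bc_inc bcA1) starM mulrA.
Qed.

Context (E1 : A1 -> A) (m : seq A1).
Hypotheses (ceE1 : cond_exp (range inc) (inc \o E1)) (qbE1 : quasi_basis (inc \o E1) m).

Lemma traceD S T : EB (E1 (S + T)) = EB (E1 S) + EB (E1 T).
Proof.
rewrite -(ceD ceEB); congr EB; apply: inc_inj.
by rewrite incD; apply: (ceD ceE1).
Qed.

(** [E1 (star S * S)] has the form [star z * z], and [EB (star z * z)] the form [star v * v]. The
    vanishing sum forces [v = 0]; faithfulness of [EB] gives [z = 0], and that of [inc \o E1] gives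
    [S = 0]. *)
Lemma trace_faithful S T :
  EB (E1 (star S * S)) + EB (E1 (star T * T)) = 0 -> S = 0.
Proof.
have pos U : exists2 z, inc (E1 (star U * U)) = inc (star z * z) &
    exists v, EB (star z * z) = star v * v.
  have [_ [z _ <-] eqz] := ce_pos ceE1 U; exists z; first by rewrite incM inc_star.
  by have [v _] := ce_pos ceEB z; exists v.
have [z eqz [v eqv]] := pos S; have [z' eqz' [v' eqv']] := pos T.
rewrite (inc_inj eqz) (inc_inj eqz') eqv eqv' => sum0.
(* [cnorm_sum_squares] is used with [k := star v], for which [k * star k = star v * v]. *)
have v0 : v = 0.
  apply: cnorm_eq0; apply/eqP; rewrite -sqrf_eq0 eq_le exprn_ge0 ?cnorm_ge0 // andbT.
  by have := cnorm_sum_squares v' (star v); rewrite starK addrC sum0 cnorm0 mulr0 cnorm_star.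
have z0 : z = 0 by apply: ce_tower_faithful; rewrite eqv v0 mulr0.
apply: (ce_faithful _ _ ceE1 qbE1); rewrite /=.
- by exists 1; rewrite ?inc1.
- by move=> _ [a _ <-]; exists (star a); rewrite ?inc_star.
- by rewrite eqz z0 mulr0 inc0.
Qed.

End Tower.

(** * Functional calculus and vanishing entropy *)

Lemma functional_calculus_eta (R : realType) (A : cstarAlgType R) (a : A) Phi :
  functional_calculus a Phi ->
  exists2 s, star s = s & Phi (@eta R) = s * s + (a - a * a).
Proof.
move=> fc.
(* [f] is nonnegative by [eta_ge], so [s := Phi g] is self-adjoint with square [Phi f]. *)
pose f t : R := eta t - (t - t * t); pose g t : R := Num.sqrt (f t).
have cid : {within spectrum a, continuous (fun t : R => t)}.
  by apply: continuous_subspaceT => t; apply: cvg_id.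
have csq : {within spectrum a, continuous (fun t : R => t * t)}.
  by apply: continuous_subspaceT => t; apply: cvgM; apply: cvg_id.
have cNsq : {within spectrum a, continuous (fun t : R => -1 * (t * t))}.
  apply: continuous_subspaceT => t.
  have h2 : (fun t : R => t * t) @ t --> t * t by apply: cvgM; apply: cvg_id.
  exact: (cvgM (cvg_cst (-1 : R)) h2).
have cf : continuous f.
  move=> t; have h1 := @continuous_eta R t.
  have h2 : (fun t : R => t * t) @ t --> t * t by apply: cvgM; apply: cvg_id.
  have h3 : (fun t : R => t) @ t --> t by apply: cvg_id.
  exact: (cvgB h1 (cvgB h3 h2)).
have cg0 : continuous g.
  by move=> t; apply: continuous_comp; [exact: cf|exact: sqrt_continuous].
have cg : {within spectrum a, continuous g} by exact: continuous_subspaceT.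
have cgg : {within spectrum a, continuous (fun t => g t * g t)}.
  by apply: continuous_subspaceT => t; exact: (cvgM (cg0 t) (cg0 t)).
have cp : {within spectrum a, continuous (fun t : R => t + -1 * (t * t))}.
  apply: continuous_subspaceT => t.
  have h2 : (fun t : R => t * t) @ t --> t * t by apply: cvgM; apply: cvg_id.
  have h3 : (fun t : R => t) @ t --> t by apply: cvg_id.
  exact: (cvgD h3 (cvgM (cvg_cst (-1 : R)) h2)).
exists (Phi g); first by apply: (fc_star fc).
(* Subtraction is written with [-1 * (t * t)] to match the sum, multiple and product rules of
   [Phi]. *)
have -> : @eta R = fun t => g t * g t + (t + -1 * (t * t)).
  apply: funext => t; rewrite -expr2 sqr_sqrtr ?subr_ge0 ?eta_ge // /f; ring.
rewrite (fc_D fc) // (fc_M fc) // (fc_D fc) // (fc_id fc) (fc_Z fc) // (fc_M fc) // (fc_id fc).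
by rewrite -[X in X *: _]/((-1)%:C)%C rmorphN rmorph1 scaleN1r.
Qed.

Theorem proposition3p5 (R : realType) (A : cstarAlgType R) (B C D : set A)
  (subB : cstar_subalgebra B) (subC : cstar_subalgebra C)
  (subD : cstar_subalgebra D)
  (BC : B `<=` C) (BD : B `<=` D)
  (simpleA : simple_algebra [set: A]) (simpleB : simple_algebra B)
  (simpleC : simple_algebra C) (simpleD : simple_algebra D)
  (irr : irreducible_inclusion B)
  (E : A -> A) (finE : index_finite B E)
  (EB EC ED ECD : A -> A)
  (minEB : minimal_cond_exp B EB) (minEC : minimal_cond_exp C EC)
  (minED : minimal_cond_exp D ED) (minECD : minimal_cond_exp (C `&` D) ECD)
  (A1 : cstarAlgType R) (rep : A1 -> A -> A) (inc : A -> A1)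
  (bcA1 : basic_construction B EB rep inc)
  (E1 : A1 -> A) (minE1 : minimal_cond_exp (range inc) (inc \o E1))
  (eC eD eCD : A1)
  (jonesC : jones_projection rep EC eC) (jonesD : jones_projection rep ED eD)
  (jonesCD : jones_projection rep ECD eCD) :
  entropy_eq EB E1 (eC * eD) 0 ->
  eC * eD = eD * eC /\ eD * eC = eCD.
Proof.
have [[ceEB [lB qbB]] _] := minEB; have [[ceE1 [l1 qb1]] _] := minE1.
have [[ceEC _] _] := minEC; have [[ceED _] _] := minED; have [[ceECD _] _] := minECD.
have C1 := subalg_1 subC; have D1 := subalg_1 subD.
have CD1 : (C `&` D) 1 by split.
have BCD : B `<=` C `&` D by move=> b Bb; split; [apply: BC|apply: BD].
have sC := jones_projection_selfadjoint subB irr ceEB qbB bcA1 C1 (subalg_star subC) BC ceEC jonesC.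
have sD := jones_projection_selfadjoint subB irr ceEB qbB bcA1 D1 (subalg_star subD) BD ceED jonesD.
have iC := jones_projection_idem bcA1 ceEC jonesC.
have iD := jones_projection_idem bcA1 ceED jonesD.
move=> [Phi [fc]]; rewrite rmorph0 scale0r.
have [s ss ->] := functional_calculus_eta fc.
pose r := (1 - eD) * eC * eD.
have -> : s * s + (star (eC * eD) * (eC * eD) -
    star (eC * eD) * (eC * eD) * (star (eC * eD) * (eC * eD))) =
    star r * r + star s * s.
  have qD : (1 - eD) * (1 - eD) = 1 - eD.
    by rewrite mulrBl mul1r mulrBr mulr1 iD subrr subr0.
  rewrite ss addrC; congr (_ + _).
  have -> : star (eC * eD) * (eC * eD) = eD * eC * eD.
    by rewrite starM sC sD !mulrA -(mulrA eD eC eC) iC.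
  have -> : star r * r = eD * eC * ((1 - eD) * (1 - eD)) * eC * eD.
    by rewrite /r !starM starB star1 sC sD !mulrA.
  rewrite qD mulrBr mulr1 !mulrBl -(mulrA eD eC eC) iC; congr (_ - _).
  by rewrite !mulrA -(mulrA _ eD eD) iD.
rewrite (traceD ceEB bcA1 ceE1) => /(trace_faithful subB ceEB qbB bcA1 ceE1 qb1) r0.
have eCDD : eC * eD = eD * eC * eD.
  by apply/eqP; rewrite -subr_eq0; apply/eqP; rewrite -[RHS]r0 /r; ncring.
have comm : eC * eD = eD * eC.
  (* The right side of [eCDD] is self-adjoint, so its left side equals its own adjoint [eD * eC]. *)
  have := congr1 star eCDD; rewrite !starM sC sD mulrA => ->.
  by rewrite eCDD.
split=> //; apply: (rep_inj bcA1) => x; rewrite (bc_M bcA1) jonesC jonesD jonesCD.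
(* Commutation gives [ED (EC x) = EC (ED x)], so this element lies in both [C] and [D], as [ECD x]
   does. *)
have GC : C (ED (EC x)).
  rewrite -jonesC -jonesD -(bc_M bcA1) -comm (bc_M bcA1) jonesC; exact: (ce_in ceEC).
have Gd : D (ED (EC x)) by exact: (ce_in ceED).
have [KC KD] := ce_in ceECD x.
have subP (P : set A) : cstar_subalgebra P -> forall y z, P y -> P z -> P (z - y).
  move=> sP y z Py Pz; apply: (subalg_D sP) => //.
  by rewrite -scaleN1r; apply: (subalg_Z sP).
(* As [star d] lies in [C] and in [D], it moves inside each expectation, and [tow] removes them:
   [EB (star d * ECD x)] and [EB (star d * ED (EC x))] both equal [EB (star d * x)]. Hence
   [EB (star d * d) = 0]. *)
pose d := ECD x - ED (EC x).
have dC : C (star d) by apply: (subalg_star subC); apply: subP.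
have dD : D (star d) by apply: (subalg_star subD); apply: subP.
have tow := ce_tower subB irr ceEB qbB.
apply/esym/eqP; rewrite -subr_eq0; apply/eqP; apply: (ce_tower_faithful subB ceEB qbB).
rewrite -/d {2}/d mulrBr (ceB ceEB).
rewrite -(ceMl CD1 ceECD) // -(ceMl D1 ceED) // (tow _ _ CD1 BCD ceECD) (tow _ _ D1 BD ceED).
by rewrite -(ceMl C1 ceEC) // (tow _ _ C1 BC ceEC) subrr.
Qed.
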